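(* Consider the feedback system with distributed sensing and uncertain measurement map described in the context, with nominal loop transfer function $K(s)$, relative uncertainty level $\varepsilon>0$, and $N_0$ nonzero eigenvalues of $L=B^TB$. Suppose that there exists a real $s>0$ for which $\bar K(s)^{-1}$ exists and has all entries bounded in absolute value by some $\varepsilon_b<1/N_0$, and that some admissible sensing model error $\Delta$ leads to a disturbance $\Phi=\Phi_b$ for some $b\in\{1,\dots,N_0\}$, where $(\Phi_b)_{b,b}=\phi_b<0$ and $(\Phi_b)_{k,l}=0$ for all $(k,l)\neq(b,b)$, with $|\phi_b|>1+N_0\,\varepsilon_b$. Then the system is not robustly stable.
   Context: There are $M$ subsystems with $N$-dimensional outputs, $N_y=NM$, and $q_k=\{kN+1,\dots,(k+1)N\}$ indexes the outputs of subsystem $k$. The nominal measurement map $B\in\mathbb{R}^{N_z\times N_y}$, $N_z\ge N_y$, gives relative measurements: for each row $l$ there are distinct subsystems $j,k$ with $(B)_{l,m}=0$ for $m\notin q_j\cup q_k$, $\sum_{m\in q_j}|(B)_{l,m}|=\sum_{m\in q_j}(B)_{l,m}=1$ and $\sum_{m\in q_k}|(B)_{l,m}|=-\sum_{m\in q_k}(B)_{l,m}=1$. These measurements are local: subsystems have positions $p(k)\in\mathbb{R}^\gamma$ with $\|p(k)-p(l)\|\ge1$ for $k\neq l$, and rows of $B$ only compare subsystems with $\|p(j)-p(k)\|\le\rho$, for a fixed $\rho\ge1$. Write $L=B^TB=Q\Lambda Q^T$ with $Q$ orthogonal and $\Lambda$ diagonal with entries $\lambda_1\ge\dots\ge\lambda_{N_y}\ge0$;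 $N_0$ is the index of the last nonzero eigenvalue. The actual measurement map is $B+\Delta$, where the sensing model error $\Delta\in\mathbb{R}^{N_z\times N_y}$ is unknown; it is admissible if $|(\Delta)_{k,l}|\le\varepsilon\,|(B)_{k,l}|$ for all $k,l$. Each $\Delta$ leads to the disturbance $\Phi=\Lambda^{+}Q^TB^T\Delta Q\in\mathbb{R}^{N_y\times N_y}$, where $\Lambda^+$ is the pseudo-inverse of $\Lambda$ (so rows $N_0+1,\dots,N_y$ of $\Phi$ are zero). The loop transfer function $K(s)\in\mathbb{C}^{N_y\times N_y}$ is a matrix transfer function (of a system with real coefficients, so $K(s)$ is a real matrix for real $s$) of the form $K(s)=K_b(s)\Lambda$, so its columns $N_0+1,\dots,N_y$ are zero; in noise-free closed loop the transformed output is $\tilde y(s)=[I_{N_y}+K(s)(I_{N_y}+\Phi)]^{-1}\delta(s)$, with $\delta$ the open-loop deviation caused by disturbances. $\bar K(s)$ denotes the $N_0\times N_0$ matrix formed by the first $N_0$ rows and columns of $K(s)$. Robust stability requires that, for every admissible $\Delta$, all zeros $s$ of $\det(I_{N_y}+K(s)[I_{N_y}+\Phi])$ have negative real part; ''not robustly stable'' means that this fails for some admissible $\Delta$. *)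

(* Defs.v *)
From mathcomp Require Import all_boot all_order all_algebra.
From mathcomp Require Import complex.
From mathcomp Require Import all_classical all_reals all_analysis.

Set Implicit Arguments.
Unset Strict Implicit.
Unset Printing Implicit Defensive.

Import Order.TTheory GRing.Theory Num.Theory.
Import numFieldNormedType.Exports.

Local Open Scope ring_scope.
Local Open Scope complex_scope.

(* Subsystems, outputs and measurements are indexed from 0. *)

Definition outputs_of (N M : nat) (k : 'I_M) : {set 'I_(N * M)} :=
  [set m : 'I_(N * M) | (k * N <= m < k.+1 * N)%N].

(* The norm that MathComp-Analysis puts on 'rV[R]_n is the maximum norm. *)
Definition euclidean_norm (R : realType) (n : nat) (x : 'rV[R]_n) : R :=
  Num.sqrt (\sum_(i < n) x 0 i ^+ 2).

Definition separated_positions (R : realType) (M gamma : nat)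
    (p : 'I_M -> 'rV[R]_gamma) : Prop :=
  forall k l : 'I_M, k != l -> 1 <= euclidean_norm (p k - p l).

Definition compares (R : realType) (N M Nz : nat) (B : 'M[R]_(Nz, N * M))
    (l : 'I_Nz) (j k : 'I_M) : Prop :=
  [/\ j != k,
      forall m, m \notin outputs_of N j :|: outputs_of N k -> B l m = 0,
      \sum_(m in outputs_of N j) `|B l m| = 1
        /\ \sum_(m in outputs_of N j) B l m = 1
    & \sum_(m in outputs_of N k) `|B l m| = 1
        /\ - (\sum_(m in outputs_of N k) B l m) = 1].

Definition local_relative_measurements (R : realType) (N M Nz gamma : nat)
    (p : 'I_M -> 'rV[R]_gamma) (rho : R) (B : 'M[R]_(Nz, N * M)) : Prop :=
  forall l : 'I_Nz, exists j k : 'I_M,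
    compares B l j k /\ euclidean_norm (p j - p k) <= rho.

Definition ordered_eigendecomposition (R : realType) (n : nat)
    (L Q : 'M[R]_n) (lambda : 'rV[R]_n) : Prop :=
  [/\ Q *m Q^T = 1%:M,
      L = Q *m diag_mx lambda *m Q^T,
      forall i j : 'I_n, (i <= j)%N -> lambda 0 j <= lambda 0 i
    & forall i : 'I_n, 0 <= lambda 0 i].

(* Counted from 1, so that the nonzero eigenvalues are those of index
   i < last_nonzero lambda when counted from 0; it is 0 if there are none. *)
Definition last_nonzero (R : realType) (n : nat) (lambda : 'rV[R]_n) : nat :=
  \max_(i < n | lambda 0 i != 0) i.+1.

Lemma last_nonzero_le (R : realType) (n : nat) (lambda : 'rV[R]_n) :
  (last_nonzero lambda <= n)%N.
Proof. by apply/bigmax_leqP => i _; exact: ltn_ord. Qed.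

Definition lead_ord (R : realType) (n : nat) (lambda : 'rV[R]_n)
    (i : 'I_(last_nonzero lambda)) : 'I_n :=
  widen_ord (last_nonzero_le lambda) i.

(* In a field 0^-1 = 0, so zero diagonal entries stay zero;
   diag_pinvP gives the four Penrose identities. *)
Definition diag_pinv (R : realType) (n : nat) (lambda : 'rV[R]_n) : 'M[R]_n :=
  diag_mx (map_mx GRing.inv lambda).

Lemma diag_pinvP (R : realType) (n : nat) (lambda : 'rV[R]_n)
    (A := diag_mx lambda) (P := diag_pinv lambda) :
  [/\ A *m P *m A = A, P *m A *m P = P,
      (A *m P)^T = A *m P & (P *m A)^T = P *m A].
Proof.
have mulVK (x : R) : x * x^-1 * x = x.
  by have [->|x0] := eqVneq x 0; rewrite ?mulr0 // divff ?mul1r.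
rewrite /P /A /diag_pinv !mulmx_diag !tr_diag_mx; split=> //; congr diag_mx;
  apply/rowP => i; rewrite !mxE ?mulVK //.
by have := mulVK (lambda 0 i)^-1; rewrite invrK.
Qed.

Definition admissible (R : realType) (m n : nat) (eps : R)
    (B Delta : 'M[R]_(m, n)) : Prop :=
  forall k l, `|Delta k l| <= eps * `|B k l|.

Definition disturbance (R : realType) (m n : nat) (B : 'M[R]_(m, n))
    (Q : 'M[R]_n) (lambda : 'rV[R]_n) (Delta : 'M[R]_(m, n)) : 'M[R]_n :=
  diag_pinv lambda *m Q^T *m B^T *m Delta *m Q.

Definition complex_mx (R : realType) (m n : nat) (A : 'M[R]_(m, n)) :
    'M[R[i]]_(m, n) :=
  map_mx (real_complex R) A.

(* D is the set of points at which K is defined (for a rational K, the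
   complement of its poles); values of K outside D are meaningless.  The last
   condition expresses real coefficients, and makes K s real for real s. *)
Record real_transfer_function (R : realType) (n : nat) (D : set R[i])
    (K : R[i] -> 'M[R[i]]_n) : Prop := RealTransferFunction {
  rtf_open : open (D : set (R[i])^o);
  rtf_holomorphic : forall (k l : 'I_n) (s : R[i]), D s ->
    derivable (fun z : (R[i])^o => K z k l : (R[i])^o) s 1;
  rtf_conj : forall s : R[i], D s ->
    D (s^*)%C /\ K (s^*)%C = map_mx (fun z : R[i] => (z^*)%C) (K s)
}.

Definition leading_block (R : realType) (n : nat) (lambda : 'rV[R]_n)
    (A : 'M[R[i]]_n) : 'M[R[i]]_(last_nonzero lambda) :=
  mxsub (@lead_ord R n lambda) (@lead_ord R n lambda) A.

Definition zeros_stable (R : realType) (n : nat) (D : set R[i])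
    (K : R[i] -> 'M[R[i]]_n) (Phi : 'M[R]_n) : Prop :=
  forall s : R[i], D s ->
    \det (1%:M + K s *m (1%:M + complex_mx Phi)) = 0 -> complex.Re s < 0.

Definition not_robustly_stable (R : realType) (m n : nat) (eps : R)
    (B : 'M[R]_(m, n)) (Q : 'M[R]_n) (lambda : 'rV[R]_n)
    (D : set R[i]) (K : R[i] -> 'M[R[i]]_n) : Prop :=
  exists Delta : 'M[R]_(m, n),
    admissible eps B Delta
    /\ ~ zeros_stable D K (disturbance B Q lambda Delta).

(* Main.v *)
Require Import Defs.
From mathcomp Require Import all_boot all_order all_algebra.
From mathcomp Require Import complex ring lra.
From mathcomp Require Import all_classical all_reals all_analysis.

Set Implicit Arguments.
Unset Strict Implicit.
Unset Printing Implicit Defensive.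

Import Order.TTheory GRing.Theory Num.Theory.
Import numFieldNormedType.Exports.
Local Open Scope ring_scope.
Local Open Scope complex_scope.

(** The set of admissible errors is star-shaped about [0], so with [Delta_b]
    every [t *: Delta_b] with [0 <= t <= 1] is admissible, and it leads to the
    disturbance [t *: Phi_b].  It is enough to find one such [t] for which the
    given real point [s > 0] is itself a closed-loop zero.

    At [s] the matrix [K s] is real.  As [K s] has only its [N_0] leading
    columns nonzero, Sylvester's identity reduces the closed-loop determinant to
    that of [1 + (1 + t *: Phibar) *m Kbar], which is a multiple of
    [g t = \det (Kbar^-1 + 1 + t *: Phibar)] ([det_loop]).  Here [Phibar]
    has the single nonzero entry [phi_b], so [g] is affine in [t], and it has a
    root in [[0, 1]] once [g 0] and [g 1] have opposite signs.

    The signs come from diagonal dominance.  The entries of [Kbar^-1] are at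
    most [eps_b < 1 / N_0], so [Kbar^-1 + 1] is strictly diagonally dominant;
    and since [1 + phi_b < - N_0 eps_b], so is [Kbar^-1 + 1 + Phibar] after
    changing the sign of its row [b].  Both have a positive diagonal after that
    change, and they differ in row [b] only; every matrix on the segment between
    them is therefore strictly diagonally dominant, hence nonsingular, and
    the determinant keeps its sign along the segment.  Undoing the sign change
    gives [g 0 * g 1 < 0] ([rank_one_shift_singular]). *)

(** * Determinants *)

(** Levy-Desplanques: in a kernel vector, the row of an entry of largest modulus
    contradicts dominance. *)
Lemma det_diag_dominant_neq0 (R : realFieldType) (n : nat) (A : 'M[R]_n) :
  (forall i, \sum_(j | j != i) `|A i j| < `|A i i|) -> \det A != 0.
Proof.
move=> domA; rewrite -det_tr; apply/negP => /det0P[v /rV0Pn[i0 vi0] vA0].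
have [i _ vmax] := Order.TotalTheory.arg_maxP (fun k => `|v 0 k|)
  (isT : predT i0).
have vi_gt0 : 0 < `|v 0 i|.
  by apply: lt_le_trans (vmax i0 isT); rewrite normr_gt0.
have := congr1 (fun M : 'rV_n => M 0 i) vA0.
rewrite !mxE (bigD1 i) //= mxE => /eqP; rewrite addr_eq0 => /eqP Evi.
have := domA i; rewrite -(ltr_pM2l vi_gt0) -normrM Evi normrN.
rewrite ltNge => /negP; apply.
apply: le_trans (ler_norm_sum _ _ _) _; rewrite mulr_sumr; apply: ler_sum => j _.
by rewrite mxE normrM ler_wpM2r //; exact: vmax.
Qed.

(** Sylvester's identity: eliminate in both orders in the block matrix
    [[1, - U; V, 1]]. *)
Lemma det_1_add_mulmxC (R : comNzRingType) (m n : nat)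
    (U : 'M[R]_(m, n)) (V : 'M[R]_(n, m)) :
  \det (1%:M + U *m V) = \det (1%:M + V *m U).
Proof.
pose W := block_mx 1%:M (- U) V 1%:M.
have EW1 : block_mx 1%:M U 0 1%:M *m W = block_mx (1%:M + U *m V) 0 V 1%:M.
  by rewrite mulmx_block !mul1mx !mulmx1 !mul0mx !add0r addNr.
have EW2 : block_mx 1%:M 0 (- V) 1%:M *m W
    = block_mx 1%:M (- U) 0 (1%:M + V *m U).
  rewrite mulmx_block !mul1mx !mulmx1 !mul0mx !addr0 addNr.
  by rewrite mulNmx mulmxN opprK addrC.
have := congr1 determinant EW1; have := congr1 determinant EW2.
rewrite !det_mulmx !det_lblock !det_ublock !det1 !mul1r !mulr1 => -> ->.
by [].
Qed.

(** Only row [b] is combined, so that the determinant is linear in [(x, y)] even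
    when the coefficients do not sum to [1], as when row [b] of [C] is negated
    ([det_mix_row]). *)
Definition mix_row (R : pzRingType) (n : nat) (b : 'I_n) (x y : R)
    (A C : 'M[R]_n) : 'M[R]_n :=
  \matrix_(i, j) (if i == b then x * A i j + y * C i j else A i j).

Lemma det_mix_row (R : comNzRingType) (n : nat) (b : 'I_n) (x y : R)
    (A C : 'M[R]_n) :
  (forall i j, i != b -> A i j = C i j) ->
  \det (mix_row b x y A C) = x * \det A + y * \det C.
Proof.
move=> eqAC; apply: (determinant_multilinear (i0 := b)).
- by apply/rowP => j; rewrite !mxE eqxx.
- by apply/matrixP => i j; rewrite !mxE eq_sym (negPf (neq_lift _ _)).
- apply/matrixP => i j; rewrite !mxE eq_sym (negPf (neq_lift _ _)).
  by rewrite eqAC // eq_sym neq_lift.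
Qed.

(** Both determinants below are affine in the parameter, with end values
    [\det A, - \det C] and [\det A, \det C].  If the first never vanishes, the
    end values of the second have opposite signs, and it vanishes at
    [\det A / (\det A - \det C)]. *)
Lemma mix_row_singular (R : realFieldType) (n : nat) (b : 'I_n)
    (A C : 'M[R]_n) :
  (forall i j, i != b -> A i j = C i j) ->
  (forall u : R, 0 <= u <= 1 -> \det (mix_row b (1 - u) (- u) A C) != 0) ->
  exists2 t : R, 0 <= t <= 1 & \det (mix_row b (1 - t) t A C) = 0.
Proof.
move=> eqAC nz.
have {}nz (u : R) : 0 <= u <= 1 -> (1 - u) * \det A - u * \det C != 0.
  by move=> /nz; rewrite det_mix_row // mulNr.
set a := \det A in nz *; set c := \det C in nz *.
have a_neq0 : a != 0.
  by have := nz 0; rewrite subr0 mul1r mul0r subr0 lexx ler01; exact.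
have c_neq0 : c != 0.
  have := nz 1; rewrite subrr mul1r mul0r sub0r oppr_eq0 lexx ler01; exact.
have acD (x y : R) : 0 < x -> 0 < y -> 0 <= x / (x + y) <= 1.
  move=> x0 y0; have xy0 : 0 < x + y by exact: addr_gt0.
  apply/andP; split; first by rewrite divr_ge0 // ltW.
  by rewrite ler_pdivrMr // mul1r lerDl ltW.
(* For [a] and [c] of the same sign, [u = a / (a + c)] is a zero of the
   first function, which has none. *)
have same_sign_false : 0 <= a / (a + c) <= 1 -> a + c != 0 -> False.
  move=> /nz /eqP h ac0; apply: h; field; exact: ac0.
have opp_sign : 0 <= a / (a - c) <= 1 -> a - c != 0 ->
    exists2 t : R, 0 <= t <= 1 & \det (mix_row b (1 - t) t A C) = 0.
  move=> t01 ac0; exists (a / (a - c)) => //; rewrite det_mix_row // -/a -/c.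
  by field.
have divNN (x y : R) : (- x) / (- y) = x / y by rewrite invrN mulrNN.
have [a_lt0|a_gt0|a0] := ltgtP a 0; last by rewrite a0 eqxx in a_neq0.
- have [c_lt0|c_gt0|c0] := ltgtP c 0; last by rewrite c0 eqxx in c_neq0.
  + case: same_sign_false; last by rewrite lt_eqF //; lra.
    by rewrite -divNN opprD acD // oppr_gt0.
  + apply: opp_sign; last by rewrite lt_eqF //; lra.
    by rewrite -divNN opprB [c - a]addrC acD // oppr_gt0.
- have [c_lt0|c_gt0|c0] := ltgtP c 0; last by rewrite c0 eqxx in c_neq0.
  + by apply: opp_sign; [rewrite acD // oppr_gt0 | rewrite gt_eqF //; lra].
  + by case: same_sign_false; [rewrite acD | rewrite gt_eqF //; lra].
Qed.

Lemma sum_offdiag_le (R : realFieldType) (n : nat) (i : 'I_n) (e : R)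
    (f : 'I_n -> R) :
  (forall j, j != i -> f j <= e) -> \sum_(j | j != i) f j <= n%:R * e - e.
Proof.
move=> fe; apply: le_trans (ler_sum _ fe) _.
rewrite sumr_const cardC1 card_ord.
case: n i {f fe} => [[] //|n] i /=.
by rewrite -natr1 mulrDl mul1r addrK mulr_natl.
Qed.

(** The determinant along [t] is affine, with end values of opposite signs:
    negating row [b] of [E + 1 + phi *: delta_mx b b] makes it diagonally
    dominant with positive diagonal, as [E + 1] is, and no singular matrix lies
    on the segment between the two. *)
Lemma rank_one_shift_singular (R : realFieldType) (n : nat) (E : 'M[R]_n)
    (b : 'I_n) (e phi : R) :
  (forall i j, `|E i j| <= e) -> n%:R * e < 1 -> 1 + n%:R * e < - phi ->
  exists2 t : R, 0 <= t <= 1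
    & \det (E + (1%:M + t *: (phi *: delta_mx b b))) = 0.
Proof.
move=> Ee ne_lt1 phi_lt.
pose A := E + 1%:M; pose C := A + phi *: delta_mx b b.
have eqAC i j : i != b -> A i j = C i j.
  by move=> /negPf ib; rewrite !mxE ib mulr0 addr0.
have [|t t01 t0] := mix_row_singular eqAC; last first.
- exists t => //; rewrite -[RHS]t0; congr determinant.
  apply/matrixP => i j; rewrite !mxE; have [->|//] := eqVneq i b; last first.
    by rewrite !mulr0 addr0.
  by rewrite /=; ring.
move=> u /andP[u0 u1]; apply: det_diag_dominant_neq0 => i.
apply: (@le_lt_trans _ _ (n%:R * e - e)).
  apply: sum_offdiag_le => j ji; rewrite !mxE [i == j]eq_sym (negPf ji).
  have [ib|_] := eqVneq i b; rewrite ?addr0 //=.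
  rewrite -ib (negPf ji) mulr0 addr0 -mulrDl normrM.
  apply: le_trans (Ee i j); apply: ler_piMl => //.
  by rewrite ler_norml; apply/andP; split; lra.
apply: lt_le_trans (ler_norm _); rewrite !mxE eqxx.
have := Ee i i; rewrite ler_norml => /andP[h1 h2].
have [_|_] := eqVneq i b; rewrite ?eqxx /= ?mulr1n ?mulr1; last by lra.
set d := E i i in h1 h2 *; set r := n%:R * e in ne_lt1 phi_lt *.
(* The diagonal entry of row [b] is a convex combination of those at [u = 0] and
   [u = 1]; either exceeds [r - e], which bounds the sum of the moduli of the
   other entries of the row. *)
have posA : 0 < 1 + d - r + e by lra.
have posC : 0 < - (d + 1 + phi) - r + e by lra.
rewrite -subr_gt0.
have -> : (1 - u) * (d + 1) + - u * (d + 1 + phi) - (r - e)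
    = (1 - u) * (1 + d - r + e) + u * (- (d + 1 + phi) - r + e) by ring.
have [->|u_neq0] := eqVneq u 0; first by rewrite subr0 mul1r mul0r addr0.
by rewrite ltr_wpDl ?mulr_ge0 ?mulr_gt0 ?subr_ge0 // ?ltW // lt_neqAle eq_sym
  u_neq0.
Qed.

(** * The closed loop on the leading coordinates *)

Lemma colsub_mul_rowsub1 (R : pzRingType) (m n p : nat) (f : 'I_m -> 'I_n)
    (A : 'M[R]_(p, n)) :
  injective f -> (forall i j, j \notin codom f -> A i j = 0) ->
  colsub f A *m rowsub f 1%:M = A.
Proof.
move=> f_inj A0; apply/matrixP => i j; rewrite !mxE.
have [/codomP[k ->]|jf] := boolP (j \in codom f).
  rewrite (bigD1 k) //= big1 => [|l lk]; rewrite !mxE ?eqxx ?mulr1 ?addr0 //.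
  by rewrite (inj_eq f_inj) (negPf lk) mulr0.
rewrite A0 // big1 // => k _; rewrite !mxE; case: eqP => [Ej|_]; last first.
  by rewrite mulr0.
by rewrite -Ej codom_f in jf.
Qed.

(** [K] factors through the coordinates that carry its nonzero columns, and
    Sylvester's identity moves the determinant there. *)
Lemma det_loop (F : fieldType) (m n : nat) (f : 'I_m -> 'I_n) (K Phi : 'M[F]_n)
    (Kbar := mxsub f f K) :
  injective f -> (forall i j, j \notin codom f -> K i j = 0) ->
  (forall i j, j \notin codom f -> Phi i j = 0) -> Kbar \in unitmx ->
  \det (1%:M + K *m (1%:M + Phi))
    = \det (invmx Kbar + (1%:M + mxsub f f Phi)) * \det Kbar.
Proof.
move=> f_inj K0 Phi0 Kbar_unit.
have sub_mul : rowsub f (1%:M + Phi)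
    = (1%:M + mxsub f f Phi) *m rowsub f 1%:M.
  rewrite mulmxDl mul1mx -[in LHS](colsub_mul_rowsub1 f_inj Phi0).
  by rewrite linearD /= -mul_rowsub_mx -mxsubrc.
rewrite -[K in LHS](colsub_mul_rowsub1 f_inj K0) -mulmxA.
rewrite mul_rowsub_mx mul1mx det_1_add_mulmxC sub_mul -mulmxA.
rewrite mul_rowsub_mx mul1mx -mxsubrc -/Kbar.
by rewrite -det_mulmx [in RHS]mulmxDl mulVmx.
Qed.

(** * Scaling the sensing model error *)

Lemma lead_ord_inj (R : realType) (n : nat) (lambda : 'rV[R]_n) :
  injective (@lead_ord R n lambda).
Proof. by move=> i j /(congr1 val) /= /val_inj. Qed.

Lemma notin_lead_ord (R : realType) (n : nat) (lambda : 'rV[R]_n) (i : 'I_n) :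
  i \notin codom (@lead_ord R n lambda) -> lambda 0 i = 0.
Proof.
move=> /negP inlead; apply/eqP; apply: contrapT => /negP li; apply: inlead.
have i_lt : (i < last_nonzero lambda)%N by exact: leq_bigmax_cond.
by apply/codomP; exists (Ordinal i_lt); apply: val_inj.
Qed.

Lemma admissibleZ (R : realType) (m n : nat) (eps t : R)
    (B Delta : 'M[R]_(m, n)) :
  0 <= t <= 1 -> admissible eps B Delta -> admissible eps B (t *: Delta).
Proof.
move=> /andP[t0 t1] adm k l; apply: le_trans (adm k l).
by rewrite mxE normrM (ger0_norm t0) ler_piMl.
Qed.

Lemma disturbanceZ (R : realType) (m n : nat) (B : 'M[R]_(m, n)) (Q : 'M[R]_n)
    (lambda : 'rV[R]_n) (t : R) (Delta : 'M[R]_(m, n)) :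
  disturbance B Q lambda (t *: Delta) = t *: disturbance B Q lambda Delta.
Proof. by rewrite /disturbance -scalemxAr -scalemxAl. Qed.

(** A point of the real axis is its own conjugate, so [K] takes real values
    there. *)
Lemma real_transfer_function_real (R : realType) (n : nat) (D : set R[i])
    (K : R[i] -> 'M[R[i]]_n) (s : R) :
  real_transfer_function D K -> D s%:C -> exists A, K s%:C = complex_mx A.
Proof.
move=> rtf Ds; exists (map_mx (@complex.Re R) (K s%:C)).
have [_] := rtf_conj rtf Ds; rewrite conjc_real => Kconj.
apply/matrixP => i j; have := congr1 (fun X : 'M[R[i]]_n => X i j) Kconj.
by rewrite !mxE; case: (K _ i j) => x y [] /eqP; rewrite -addr_eq0 -mulr2n
  mulrn_eq0 => /eqP ->.
Qed.

Theorem proposition2 (R : realType) (N M Nz gamma : nat)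
  (p : 'I_M -> 'rV[R]_gamma) (rho : R) (B : 'M[R]_(Nz, N * M))
  (Q : 'M[R]_(N * M)) (lambda : 'rV[R]_(N * M)) (eps : R)
  (D : set R[i]) (K Kb : R[i] -> 'M[R[i]]_(N * M))
  (hNz : (N * M <= Nz)%N)
  (hp : separated_positions p)
  (hrho : 1 <= rho)
  (hB : local_relative_measurements p rho B)
  (hL : ordered_eigendecomposition (B^T *m B) Q lambda)
  (heps : 0 < eps)
  (hK : real_transfer_function D K)
  (hKb : forall s : R[i], D s -> K s = Kb s *m complex_mx (diag_mx lambda))
  (s eps_b : R) (hs : 0 < s) (hsD : D s%:C)
  (heps_b : eps_b < (last_nonzero lambda)%:R^-1)
  (hKinv : leading_block lambda (K s%:C) \in unitmx)
  (hKinv_bound : forall k l,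
     `|invmx (leading_block lambda (K s%:C)) k l| <= eps_b%:C)
  (Delta_b : 'M[R]_(Nz, N * M)) (hDelta_b : admissible eps B Delta_b)
  (b : 'I_(last_nonzero lambda)) (phi_b : R)
  (hphi_b : phi_b < 0)
  (hPhi_bb : disturbance B Q lambda Delta_b (lead_ord b) (lead_ord b) = phi_b)
  (hPhi_kl : forall k l, (k, l) != (lead_ord b, lead_ord b) ->
     disturbance B Q lambda Delta_b k l = 0)
  (hphi_b_large : 1 + (last_nonzero lambda)%:R * eps_b < `|phi_b|) :
  not_robustly_stable eps B Q lambda D K.
Proof.
have [A EK] := real_transfer_function_real hK hsD.
have A0 i j : j \notin codom (@lead_ord R _ lambda) -> A i j = 0.
  move=> /notin_lead_ord lj; apply: complexI.
  have := congr1 (fun X : 'M[R[i]]_(N * M) => X i j) (hKb _ hsD).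
  rewrite EK /complex_mx map_diag_mx mul_mx_diag !mxE lj => ->.
  by rewrite rmorph0 mulr0.
set f := @lead_ord R _ lambda in A0.
have f_inj : injective f by exact: lead_ord_inj.
have block_real : leading_block lambda (K s%:C) = complex_mx (mxsub f f A).
  by rewrite EK /leading_block /complex_mx map_mxsub.
have A_unit : mxsub f f A \in unitmx.
  by move: hKinv; rewrite block_real /complex_mx map_unitmx.
have inv_bound k l : `|invmx (mxsub f f A) k l| <= eps_b.
  have := hKinv_bound k l.
  rewrite block_real /complex_mx -map_invmx mxE normc_def /= expr0n addr0.
  by rewrite sqrtr_sqr lecR.
have EPhi : disturbance B Q lambda Delta_b
    = phi_b *: delta_mx (lead_ord b) (lead_ord b).
  apply/matrixP => k l; rewrite [RHS]mxE [delta_mx _ _ _ _]mxE.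
  have [[-> ->]|kl] := eqVneq (k, l) (lead_ord b, lead_ord b).
    by rewrite hPhi_bb !eqxx mulr1.
  by rewrite hPhi_kl //; move: kl; rewrite xpair_eqE => /negPf ->; rewrite mulr0.
have N0_gt0 : (0 : R) < (last_nonzero lambda)%:R.
  by rewrite ltr0n; apply: leq_ltn_trans (ltn_ord b).
have [||t t01 det0] := rank_one_shift_singular b (phi := phi_b) inv_bound.
- by rewrite mulrC -ltr_pdivlMr // mul1r.
- by rewrite -(ltr0_norm hphi_b).
exists (t *: Delta_b); split; first exact: admissibleZ.
move=> /(_ _ hsD) stable; suff /stable : \det (1%:M + K s%:C *m (1%:M
    + complex_mx (disturbance B Q lambda (t *: Delta_b)))) = 0.
  by rewrite /= ltNge ltW.
rewrite EK -(map_mx1 (real_complex R)) /complex_mx -map_mxD -map_mxM -map_mxD.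
rewrite det_map_mx disturbanceZ EPhi (det_loop (f := f)) //; last first.
  move=> i j jf; rewrite !mxE; have [Ej|_] := eqVneq j (lead_ord b).
    by rewrite Ej codom_f in jf.
  by rewrite andbF !mulr0.
have -> : mxsub f f (t *: (phi_b *: delta_mx (lead_ord b) (lead_ord b)))
    = t *: (phi_b *: delta_mx b b).
  by apply/matrixP => i j; rewrite !mxE !(inj_eq f_inj).
by rewrite det0 mul0r rmorph0.
Qed.
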